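(* Let $S$ be a finite tree. Let $t_{\star} \in \mathbb{N}$ be such that $t_{\star} > |S|$ and $t_{\star} > 3$. Then $$\lim_{n \to \infty} \mathrm{TV}\left( \mathrm{CUA}(n, t_{\star}, S), \mathrm{UA}(n, S)^{\otimes 2} \right) > 0.$$
   Context: Trees are regarded as unlabeled (up to isomorphism); $|S|$ is the number of vertices of $S$. Uniform attachment (UA) trees with seed tree $S$: $T_{|S|} = S$, and given $T_t$, the tree $T_{t+1}$ is obtained by adding one new vertex and one edge joining it to an existing vertex of $T_t$ chosen uniformly at random. $\mathrm{UA}(n,S)$ denotes the law of the $n$-vertex tree $T_n$. For $t_\star \ge |S|$ and $n \geq t_{\star}$, $\mathrm{CUA}(n, t_{\star}, S)$ is the law of the pair $(T_n^1, T_n^2)$, where $T_t^1 = T_t^2 =: T_t$ for $|S| \leq t \leq t_{\star}$ is grown from $S$ by UA, and conditionally on $T_{t_{\star}}$ the sequences $\{T_t^1\}_{t \geq t_{\star}}$, $\{T_t^2\}_{t \geq t_{\star}}$ are independent UA sequences started from $T_{t_{\star}}$. $\mathrm{UA}(n,S)^{\otimes 2}$ is the law of two independent samples of $\mathrm{UA}(n,S)$. $\mathrm{TV}(P,Q) = \sup_A |P(A) - Q(A)|$; the total variation distance above is non-increasing in $n$, so the limit exists. *)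

(* Defs.v *)
From mathcomp Require Import all_boot all_order all_algebra.
From mathcomp Require Import all_classical all_reals all_analysis.

Set Implicit Arguments.
Unset Strict Implicit.
Unset Printing Implicit Defensive.

Import Order.TTheory GRing.Theory Num.Theory.
Import numFieldNormedType.Exports.

Local Open Scope classical_set_scope.
Local Open Scope ring_scope.

(* A graph with vertex set 'I_n, given by its adjacency matrix.  Symmetry and
   irreflexivity are not built in: they are part of [is_tree], and
   [attach] preserves them. *)
Notation graph n := 'M[bool]_n.

Definition adj n (G : graph n) : rel 'I_n := fun x y => G x y.

(* In a simple graph, the duplicate-free cyclic sequences of at least three
   vertices are the cycles; those of size two just traverse an edge back and
   forth. *)
Definition is_tree n (G : graph n) : Prop :=
  [/\ (0 < n)%N,
      symmetric (adj G) /\ irreflexive (adj G),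
      (forall x y, connect (adj G) x y)
    & (forall c : seq 'I_n, ucycle (adj G) c -> (size c <= 2)%N)].

Definition isomorphic m n (G : graph m) (H : graph n) : Prop :=
  exists f : 'I_m -> 'I_n,
    bijective f /\ (forall x y, adj H (f x) (f y) = adj G x y).

(* An unlabeled n-vertex graph is the isomorphism class of a labeled one, seen
   as a set of graphs on 'I_n.  Letting [unlabel n] take a graph of any order m
   avoids casts between provably equal orders; its value is the class of G when
   m = n, and the empty set otherwise. *)
Notation ugraph n := {set graph n}.

Definition unlabel n m (G : graph m) : ugraph n :=
  [set H : graph n | `[< isomorphic G H >]]%SET.

(* The old vertices are those of the form [lift ord_max _]; the new vertex is
   [ord_max], and it is joined to v only. *)
Definition attach n (G : graph n) (v : 'I_n) : graph n.+1 :=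
  \matrix_(i, j)
    match unlift ord_max i, unlift ord_max j with
    | Some x, Some y => G x y
    | Some x, None => x == v
    | None, Some y => y == v
    | None, None => false
    end.

Section FiniteLaws.
Variable R : realType.

(* Laws on a finite type are represented by their mass functions. *)
Definition law (T : finType) : Type := {ffun T -> R}.

Definition prob (T : finType) (P : law T) (A : {set T}) : R :=
  \sum_(x in A) P x.

Definition dirac_law (T : finType) (a : T) : law T :=
  [ffun x => (x == a)%:R].

Definition unif_law (T : finType) : law T := [ffun=> #|T|%:R^-1].

(* The law of y when x is drawn from P and then y from K x. *)
Definition bind (T U : finType) (P : law T) (K : T -> law U) : law U :=
  [ffun y => \sum_(x : T) P x * K x y].

Definition prod_law (T U : finType) (P : law T) (Q : law U) :
    law (T * U)%type :=
  [ffun z => P z.1 * Q z.2].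

Definition TV (T : finType) (P Q : law T) : R :=
  sup [set `|prob P A - prob Q A| | A in [set: {set T}]].

End FiniteLaws.

Section UniformAttachment.
Variable R : realType.

Definition ua_step n (G : graph n) : law R (graph n.+1) :=
  bind (unif_law R 'I_n) (fun v => dirac_law R (attach G v)).

Fixpoint ua_grow (k m : nat) (S : graph m) : law R (graph (k + m)) :=
  match k with
  | 0 => dirac_law R S
  | k'.+1 => bind (ua_grow k' S) (@ua_step (k' + m))
  end.

(* UA and CUA are meant for m <= n, resp. m <= t <= n. *)
Definition UA (n m : nat) (S : graph m) : law R (ugraph n) :=
  bind (ua_grow (n - m) S) (fun G => dirac_law R (unlabel n G)).

(* The common tree at time t is drawn first; given it, two independent uniform
   attachment trees are grown with it as seed. *)
Definition CUA (n t m : nat) (S : graph m) :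
    law R (ugraph n * ugraph n)%type :=
  bind (ua_grow (t - m) S) (fun G => prod_law (UA n G) (UA n G)).

Definition UA2 (n m : nat) (S : graph m) : law R (ugraph n * ugraph n)%type :=
  prod_law (UA n S) (UA n S).

End UniformAttachment.

(* Main.v *)
Require Import Defs.
From mathcomp Require Import all_boot all_order all_algebra.
From mathcomp Require Import all_classical all_reals all_analysis.
From mathcomp Require Import zify ring.

Set Implicit Arguments.
Unset Strict Implicit.
Unset Printing Implicit Defensive.

Import Order.TTheory GRing.Theory Num.Theory.
Import numFieldNormedType.Exports.

Local Open Scope classical_set_scope.
Local Open Scope ring_scope.

(** A test function separates the two laws.  In a tree, call a quadruple of
    vertices (a, b, c, d) linked when the path from a to b is disjoint from
    the path from c to d, and let N be the number of linked quadruples.  A new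
    vertex w attached to v sees the rest of the tree exactly as v does, so a
    quadruple that contains w once is linked iff the quadruple with v in its
    place is.  Among quadruples that contain w at least twice, only
    (w, w, c, d) and (c, d, w, w) with c, d old are linked, and these always
    are.  Averaging over v gives ([expect_step])
      E[N(T_(n+1)) | T_n] = (1 + 4/n) N(T_n) + 2 n^2 :
    the mean of N evolves by an affine recursion that depends on the tree only
    through the starting value.

    The product of the factors 1 + 4/n from t to n - 1 is
    n(n+1)(n+2)(n+3) / (t(t+1)(t+2)(t+3)) >= n^4 / (t(t+1)(t+2)(t+3)).
    Hence the density N/n^4, which lies in [0, 1] and depends on the unlabeled
    tree only, has a conditional mean given T_t that remembers N(T_t), with a
    slope bounded away from 0 uniformly in n.  Take h to be the product of the
    densities of the two trees.  Its mean is E[E[N/n^4 | T_t]^2] for the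
    correlated pair and E[N/n^4]^2 for the independent pair.  The difference
    is the variance of E[N/n^4 | T_t], so the total variation distance is at
    least Var(N(T_t)) / (t(t+1)(t+2)(t+3))^2 ([TV_CUA_ge]).

    This variance is positive ([quartets_variance_gt0]): at time t - 1 >= 3
    some tree of positive probability has a leaf l with neighbor p, and
    attaching the next vertex to l gives strictly more linked quadruples than
    attaching it to p ([quartets_at_neighbor_lt]).

    The limit exists since one more step of growth is the same kernel applied
    to both pairs of unlabeled trees, which cannot increase the total variation
    distance ([TV_CUA_nonincreasing]). *)

(** * Vertices joined inside a set of vertices *)

Definition joined n (G : graph n) (A : {set 'I_n}) (x y : 'I_n) : bool :=
  [&& x \in A, y \in A &
      connect [rel u v | [&& u \in A, v \in A & adj G u v]] x y].

Lemma joined_refl n (G : graph n) (A : {set 'I_n}) x : x \in A -> joined G A x x.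
Proof. by move=> xA; rewrite /joined xA connect0. Qed.

Lemma joined_sym n (G : graph n) (A : {set 'I_n}) x y :
  symmetric (adj G) -> joined G A x y = joined G A y x.
Proof.
move=> symG; rewrite /joined andbCA; congr [&& _, _ & _].
apply: (@sym_connect_sym _ _ _ x y) => u v /=.
by rewrite symG andbCA.
Qed.

Lemma joined_trans n (G : graph n) (A : {set 'I_n}) x y z :
  joined G A x y -> joined G A y z -> joined G A x z.
Proof.
move=> /and3P[xA _ xy] /and3P[_ zA yz].
by rewrite /joined xA zA (connect_trans xy yz).
Qed.

Lemma joined_adj n (G : graph n) (A : {set 'I_n}) x y :
  x \in A -> y \in A -> adj G x y -> joined G A x y.
Proof. by move=> xA yA xy; rewrite /joined xA yA connect1 //= xA yA. Qed.

Lemma joinedT n (G : graph n) x y :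
  connect (adj G) x y -> joined G [set: 'I_n]%SET x y.
Proof.
move=> xy; rewrite /joined !inE /=.
by rewrite (eq_connect (e' := adj G)) // => u v; rewrite /= !inE.
Qed.

(** Exposing the first edge of a path; at a leaf this edge is known. *)
Lemma joined_step n (G : graph n) (A : {set 'I_n}) x y :
  joined G A x y -> x != y ->
  exists z, [/\ adj G x z, z \in A & joined G A z y].
Proof.
move=> /and3P[xA yA /connectP[[|z p] /= ]] => [_ ->|]; first by rewrite eqxx.
move=> /andP[/and3P[_ zA xz] pth ->] _; exists z; split=> //.
rewrite /joined zA.
have zl : connect [rel u v | [&& u \in A, v \in A & adj G u v]] z (last z p).
  by apply/connectP; exists p.
rewrite zl andbT /=.
case/lastP: p pth zl => [//|p t]; rewrite rcons_path last_rcons => /andP[_].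
by case/and3P.
Qed.

Lemma homo_connect (T U : finType) (e : rel T) (e' : rel U) (r : T -> U) x y :
  (forall u v, e u v -> connect e' (r u) (r v)) ->
  connect e x y -> connect e' (r x) (r y).
Proof.
move=> er /connectP[p pth ->] {y}.
elim: p x pth => [|z p IH] x /=; first by rewrite connect0.
by move=> /andP[xz /IH]; apply: connect_trans; apply: er.
Qed.

(** A map between graphs that contracts some edges and keeps the others sends
    walks to walks.  The predicate [D] selects the vertices whose membership
    in the sets is controlled; the other vertices
    (at most one, the end of a pendant edge, in what follows) only meet
    contracted edges. *)
Lemma joined_contract m n (G : graph m) (H : graph n) (r : 'I_m -> 'I_n)
    (D : pred 'I_m) (A : {set 'I_m}) (B : {set 'I_n}) a b :
  (forall x y, adj G x y ->
     r x = r y \/ [/\ D x, D y & adj H (r x) (r y)]) ->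
  (forall x, D x -> x \in A -> r x \in B) ->
  D a -> D b -> joined G A a b -> joined H B (r a) (r b).
Proof.
move=> rG AB Da Db /and3P[aA bA ab]; rewrite /joined !AB //=.
apply: homo_connect ab => u v /= /and3P[uA vA /rG[->|[Du Dv uv]]].
  exact: connect0.
by apply: connect1; rewrite /= !AB.
Qed.

(** * Pairs of vertices joined by disjoint paths *)

(** In a tree this says that the path from a to b is disjoint from the path
    from c to d.  Two complementary sets are used instead of paths because
    preimages of sets along a map of graphs are again complementary. *)
Definition linked n (G : graph n) (a b c d : 'I_n) : bool :=
  [exists A : {set 'I_n}, joined G A a b && joined G (~: A) c d].

Lemma linkedP n (G : graph n) a b c d :
  reflect (exists2 A : {set 'I_n}, joined G A a b & joined G (~: A) c d)
          (linked G a b c d).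
Proof.
apply: (iffP existsP) => [[A /andP[]]|[A Aab Acd]]; exists A => //.
exact/andP.
Qed.

Lemma linked_swap n (G : graph n) a b c d :
  symmetric (adj G) -> linked G a b c d = linked G b a c d.
Proof. by move=> symG; apply: eq_existsb => A; rewrite joined_sym. Qed.

Lemma linkedC n (G : graph n) a b c d : linked G a b c d = linked G c d a b.
Proof.
by apply/linkedP/linkedP => -[A ? ?]; exists (~: A); rewrite // finset.setCK.
Qed.

Lemma linked_common n (G : graph n) a b d : linked G a b a d = false.
Proof.
apply/linkedP => -[A /and3P[aA _ _] /and3P[]].
by rewrite inE aA.
Qed.

(** The complementary sets in [H] are the preimages under [i] of those in [G];
    the hypotheses on [i] make it a partial inverse of [r] away from the
    contracted edges. *)
Lemma linked_contract m n (G : graph m) (H : graph n) (r : 'I_m -> 'I_n)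
    (i : 'I_n -> 'I_m) a b c d :
  (forall x y, adj G x y ->
     r x = r y \/ [/\ i (r x) = x, i (r y) = y & adj H (r x) (r y)]) ->
  i (r a) = a -> i (r b) = b -> i (r c) = c -> i (r d) = d ->
  linked G a b c d -> linked H (r a) (r b) (r c) (r d).
Proof.
move=> rG ra rb rc rd /linkedP[A Aab Acd].
have rG' : forall x y, adj G x y -> r x = r y \/
    [/\ i (r x) == x, i (r y) == y & adj H (r x) (r y)].
  by move=> x y /rG[|[? ? ?]]; [left|right; split=> //; apply/eqP].
apply/linkedP; exists (i @^-1: A).
- apply: (joined_contract (A := A) rG') => //; try exact/eqP.
  by move=> x /eqP rx xA; rewrite inE rx.
- apply: (joined_contract (A := ~: A) rG') => //; try exact/eqP.
  by move=> x /eqP rx; rewrite !inE rx.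
Qed.

Lemma linked_iso m n (G : graph m) (H : graph n) (f : 'I_m -> 'I_n) a b c d :
  bijective f -> (forall x y, adj H (f x) (f y) = adj G x y) ->
  linked H (f a) (f b) (f c) (f d) = linked G a b c d.
Proof.
move=> [g fK gK] fG; apply/idP/idP.
- rewrite -[in X in _ -> X](fK a) -[in X in _ -> X](fK b).
  rewrite -[in X in _ -> X](fK c) -[in X in _ -> X](fK d).
  apply: (linked_contract (i := f)); rewrite ?fK //.
  by move=> x y; right; rewrite !gK -fG !gK.
- apply: (linked_contract (i := g)); rewrite ?fK // => x y xy.
  by right; rewrite !fK fG.
Qed.

(** * Pendant vertices *)

Definition pendant n (G : graph n) (l p : 'I_n) : Prop :=
  l != p /\ forall x, adj G l x = (x == p).

Section Pendant.
Variables (n : nat) (G : graph n) (l p : 'I_n).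
Hypotheses (symG : symmetric (adj G)) (pend : pendant G l p).

(** Folding the leaf l onto its neighbor p contracts the only edge at l, so a
    walk between two other vertices can be made to avoid l. *)
Let fold_leaf x := if x == l then p else x.

Lemma fold_leaf_id x : x != l -> fold_leaf x = x.
Proof. by rewrite /fold_leaf => /negPf ->. Qed.

Lemma fold_leaf_adj x y : adj G x y ->
  fold_leaf x = fold_leaf y \/
  [/\ x != l, y != l & adj G (fold_leaf x) (fold_leaf y)].
Proof.
case: pend => lp adjl; rewrite /fold_leaf.
have [->|xl] := eqVneq x l.
  by rewrite adjl => /eqP ->; rewrite eq_sym (negPf lp); left.
have [->|yl] := eqVneq y l.
  by rewrite symG adjl => /eqP ->; left.
by right.
Qed.

Lemma joined_pendant (A : {set 'I_n}) b :
  b != l -> joined G A l b -> p \in A /\ joined G A p b.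
Proof.
case: pend => lp adjl bl /joined_step; rewrite eq_sym => /(_ bl)[z []].
by rewrite adjl => /eqP ->.
Qed.

Lemma joined_away (A : {set 'I_n}) c d : c != l -> d != l ->
  joined G A c d -> joined G (A :\ l) c d.
Proof.
move=> cl dl cd; rewrite -(fold_leaf_id cl) -(fold_leaf_id dl).
apply: (joined_contract (D := fun x => x != l) fold_leaf_adj _ cl dl cd).
by move=> x xl xA; rewrite fold_leaf_id // !inE xl.
Qed.

Lemma joinedS (A B : {set 'I_n}) c d :
  A \subset B -> joined G A c d -> joined G B c d.
Proof.
move=> AB; apply: (joined_contract (r := id) (D := predT)) => //.
- by move=> x y; right.
- by move=> x _; exact: (fintype.subsetP AB).
Qed.


(** A path that leaves l passes through p, and conversely l can be added to
    any set that contains p. *)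
Lemma linked_pendant b c d : b != l -> c != l -> d != l ->
  linked G l b c d = linked G p b c d.
Proof.
move=> bl cl dl; apply/linkedP/linkedP => -[A Ab Acd].
  by exists A => //; case: (joined_pendant bl Ab).
case: pend => lp adjl.
have pA : p \in A by case/and3P: Ab.
exists (l |: A).
  apply: (joined_trans (y := p)).
    by apply: joined_adj; rewrite ?adjl ?inE ?eqxx ?pA ?orbT.
  by apply: joinedS Ab; apply: finset.subsetUr.
have -> : ~: (l |: A) = ~: A :\ l by apply/finset.setP=> x; rewrite !inE negb_or.
exact: joined_away.
Qed.

Lemma linked_pendant_pair c d : connect (adj G) c d -> c != l -> d != l ->
  linked G l l c d.
Proof.
move=> cd cl dl; apply/linkedP; exists [set l]%SET.
  by apply: joined_refl; rewrite inE.
by rewrite -finset.setTD; apply: joined_away => //; apply: joinedT.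
Qed.

(** From l one cannot go anywhere without meeting p. *)
Lemma linked_neighbor b c d : linked G p b c d -> c = l -> d = l.
Proof.
move=> /linkedP[A /and3P[pA _ _] Acd] cl; rewrite cl in Acd.
apply/eqP; apply: contraT => dl.
by case: (joined_pendant dl Acd); rewrite inE pA.
Qed.

End Pendant.

(** * The number of linked quadruples *)

(** The coordinates of a quadruple need not be distinct; this is what makes the
    recursion for the mean close on this single statistic. *)
Definition quartets n (G : graph n) : nat :=
  (\sum_a \sum_b \sum_c \sum_d linked G a b c d)%N.

Definition quartets_at n (G : graph n) (v : 'I_n) : nat :=
  (\sum_b \sum_c \sum_d linked G v b c d)%N.

Lemma sum_quartets_at n (G : graph n) :
  quartets G = (\sum_v quartets_at G v)%N.
Proof. by []. Qed.

Lemma quartets_le n (G : graph n) : (quartets G <= n ^ 4)%N.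
Proof.
have S (k : nat) (F : 'I_n -> nat) : (forall x, F x <= n ^ k)%N ->
    (\sum_x F x <= n ^ k.+1)%N.
  move=> Fk; rewrite expnS -[n in (n * _)%N]card_ord -sum_nat_const.
  exact: leq_sum.
apply: (S 3) => a; apply: (S 2) => b; apply: (S 1) => c; apply: (S 0) => d.
by rewrite leq_b1.
Qed.

Lemma quartets_iso m n (G : graph m) (H : graph n) :
  isomorphic G H -> quartets G = quartets H.
Proof.
move=> [f [bijf fG]]; rewrite /quartets.
have bf : {on [pred x | true], bijective f} by exact: onW_bij.
rewrite [RHS](reindex f) //=; apply: eq_bigr => a _.
rewrite [RHS](reindex f) //=; apply: eq_bigr => b _.
rewrite [RHS](reindex f) //=; apply: eq_bigr => c _.
rewrite [RHS](reindex f) //=; apply: eq_bigr => d _.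
by rewrite (linked_iso _ _ _ _ bijf fG).
Qed.

Section LeafVersusNeighbor.
Variables (n : nat) (G : graph n) (l p : 'I_n).
Hypotheses (symG : symmetric (adj G)) (conG : forall x y, connect (adj G) x y).
Hypotheses (pend : pendant G l p) (n_ge3 : (3 <= n)%N).

Let pair_sum (F : 'I_n -> 'I_n -> nat) : nat := (\sum_c \sum_d F c d)%N.

Lemma pair_sum_leq (F F' : 'I_n -> 'I_n -> nat) :
  (forall c d, F c d <= F' c d)%N -> (pair_sum F <= pair_sum F')%N.
Proof. by move=> FF; do 2![apply: leq_sum => ? _]. Qed.

(** Compare, coordinate b by coordinate b, the linked triples (b, c, d) seen
    from p and from l.  For b <> l they agree, except that p also sees
    (b, l, l): p wins by at most n - 1 in total.  For b = l, the leaf sees all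
    (n - 1)^2 pairs (c, d) that avoid l, while p misses every pair that meets
    {l, p} and sees at most (n - 2)^2 pairs.  So l wins by at least
    (n - 1)^2 - (n - 2)^2 - (n - 1) = n - 2 > 0. *)
Lemma quartets_at_neighbor_lt : (quartets_at G p < quartets_at G l)%N.
Proof.
have [lp adjl] := pend.
have sumM (P : pred 'I_n) : pair_sum (fun c d => P c * P d)%N = (#|P| ^ 2)%N.
  have -> : #|P| = (\sum_c P c)%N by rewrite -sum1_card big_mkcond.
  rewrite /pair_sum -mulnn big_distrl; apply: eq_bigr => c _.
  by rewrite big_distrr.
have offl b : b != l ->
    (pair_sum (linked G p b) <= pair_sum (linked G l b) + 1)%N.
  move=> bl.
  have -> : 1%N = pair_sum (fun c d => (c == l) * (d == l))%N.
    by rewrite (sumM (pred1 l)) card1.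
  rewrite /pair_sum -big_split; apply: leq_sum => c _.
  rewrite -big_split; apply: leq_sum => d _ /=.
  have [cl|cl] := eqVneq c l; last first.
    have [dl|dl] := eqVneq d l; last by rewrite -(linked_pendant symG pend) ?addn0.
    rewrite mul0n addn0 linkedC linked_swap // linkedC.
    case Q: (linked _ _ _ _ _) => //.
    by rewrite (linked_neighbor pend Q dl) eqxx in cl.
  have [dl|dl] := eqVneq d l; first by rewrite (leq_trans (leq_b1 _)) ?leq_addl.
  case Q: (linked _ _ _ _ _) => //.
  by rewrite (linked_neighbor pend Q cl) eqxx in dl.
have atl : ((n - 1) ^ 2 <= pair_sum (linked G l l))%N.
  have -> : (n - 1)%N = #|predC1 l| by rewrite cardC1 card_ord subn1.
  rewrite -sumM.
  apply: pair_sum_leq => c d /=.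
  by have [//|cl] := eqVneq c l; have [//|dl] := eqVneq d l;
     rewrite (linked_pendant_pair symG pend).
have atp : (pair_sum (linked G p l) <= (n - 2) ^ 2)%N.
  have c2 : #|predC (pred2 l p)| = (n - 2)%N.
    have := cardC (pred2 l p); rewrite card2 lp card_ord /= => nE.
    by rewrite -[X in (X - 2)%N]nE addKn.
  rewrite -c2 -sumM; apply: pair_sum_leq => c d /=.
  have bad x y : linked G p l x y -> predC (pred2 l p) x.
    move=> Q /=; apply/norP; split; apply/negP => /eqP xE; rewrite xE in Q.
      by move: Q; rewrite linked_swap // linked_common.
    by move: Q; rewrite linked_common.
  case Q: (linked _ _ _ _ _) => //; have /= -> := bad _ _ Q.
  by move: Q; rewrite linkedC linked_swap // linkedC => /bad /= ->.
rewrite /quartets_at (bigD1 l) //= [X in (_ < X)%N](bigD1 l) //=.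
have := @leq_sum _ (index_enum 'I_n) (fun b => b != l) _ _ offl.
rewrite big_split /= sum_nat_const cardC1 card_ord muln1.
move=> offl_sum.
apply: leq_ltn_trans (leq_add atp offl_sum) _.
apply: leq_trans (leq_add atl (leqnn _)).
by rewrite addnCA addnC ltn_add2r; nia.
Qed.

End LeafVersusNeighbor.

(** * Attaching a vertex *)

Definition graph_connected n (G : graph n) : Prop :=
  symmetric (adj G) /\ forall x y, connect (adj G) x y.

Section Attach.
Variables (n : nat) (G : graph n) (v : 'I_n).

Let old : 'I_n -> 'I_n.+1 := lift ord_max.
Let new : 'I_n.+1 := ord_max.

(** The contraction of the new edge; its restriction to old vertices is the
    inverse of [old]. *)
Let host x := odflt v (unlift ord_max x).

Variant vertex_spec : 'I_n.+1 -> Type :=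
  | OldVertex x : vertex_spec (old x)
  | NewVertex : vertex_spec new.

Lemma vertexP x : vertex_spec x.
Proof. by case: (unliftP ord_max x) => [y ->|->]; constructor. Qed.

Lemma adj_old x y : adj (attach G v) (old x) (old y) = adj G x y.
Proof. by rewrite /adj mxE !liftK. Qed.

Lemma adj_new_old x : adj (attach G v) new (old x) = (x == v).
Proof. by rewrite /adj mxE unlift_none liftK. Qed.

Lemma adj_old_new x : adj (attach G v) (old x) new = (x == v).
Proof. by rewrite /adj mxE unlift_none liftK. Qed.

Lemma adj_new : adj (attach G v) new new = false.
Proof. by rewrite /adj mxE unlift_none. Qed.

Lemma attach_sym : symmetric (adj G) -> symmetric (adj (attach G v)).
Proof.
move=> symG x y; case: (vertexP x) => [x'|]; case: (vertexP y) => [y'|] //.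
- by rewrite !adj_old.
- by rewrite adj_old_new adj_new_old.
- by rewrite adj_old_new adj_new_old.
Qed.

Lemma pendant_attach : pendant (attach G v) new (old v).
Proof.
split=> [|x]; first exact: neq_lift.
case: (vertexP x) => [x'|]; last by rewrite adj_new (negPf (neq_lift _ _)).
by rewrite adj_new_old (inj_eq lift_inj).
Qed.

Lemma attach_connected : graph_connected G -> graph_connected (attach G v).
Proof.
move=> [symG conG]; split; first exact: attach_sym.
have symA := sym_connect_sym (attach_sym symG).
have oldv x : connect (adj (attach G v)) (old v) x.
  case: (vertexP x) => [x'|].
    apply: homo_connect (conG v x') => a b ab.
    by apply: connect1; rewrite adj_old.
  by apply: connect1; rewrite adj_old_new.
move=> x y; apply: connect_trans (oldv y).
by rewrite symA.
Qed.

Let host_old x : host (old x) = x. Proof. by rewrite /host liftK. Qed.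

(** Contracting the new edge and adding it back show the two implications. *)
Lemma linked_old a b c d :
  linked (attach G v) (old a) (old b) (old c) (old d) = linked G a b c d.
Proof.
apply/idP/idP.
- rewrite -[in X in _ -> X](host_old a) -[in X in _ -> X](host_old b).
  rewrite -[in X in _ -> X](host_old c) -[in X in _ -> X](host_old d).
  apply: (linked_contract (i := old)); rewrite ?host_old // => x y.
  case: (vertexP x) => [x'|]; case: (vertexP y) => [y'|].
  + by rewrite adj_old !host_old; right.
  + by rewrite adj_old_new host_old /host unlift_none => /eqP ->; left.
  + by rewrite adj_new_old host_old /host unlift_none => /eqP ->; left.
  + by rewrite adj_new.
- apply: (linked_contract (i := host)); rewrite ?host_old // => x y xy.
  by right; rewrite !host_old adj_old.
Qed.

Hypothesis conG : graph_connected G.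
Let symA : symmetric (adj (attach G v)) := attach_sym conG.1.

Lemma linked_new b c d :
  linked (attach G v) new (old b) (old c) (old d) = linked G v b c d.
Proof.
rewrite (linked_pendant symA pendant_attach) ?linked_old //;
by rewrite eq_sym neq_lift.
Qed.

(** Removing the new vertex leaves the old vertices connected. *)
Lemma linked_new_new c d : linked (attach G v) new new (old c) (old d).
Proof.
apply: (linked_pendant_pair symA pendant_attach);
  rewrite 1?eq_sym ?neq_lift //.
by have [_ ->] := attach_connected conG.
Qed.

(** The quadruples are sorted by the places where the new vertex occurs: at
    none, at one of four (each contributing [quartets_at G v]), or at both
    ends of the same path (n^2 for each of the two paths). *)
Lemma quartets_attach :
  quartets (attach G v) = (quartets G + 4 * quartets_at G v + 2 * n ^ 2)%N.
Proof.
pose Q := linked (attach G v).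
have sumS (F : 'I_n.+1 -> nat) :
    (\sum_x F x = F new + \sum_x F (old x))%N by exact: bigD1_ord.
have Qs a b c d : Q a b c d = Q b a c d by exact: linked_swap.
have QC a b c d : Q a b c d = Q c d a b by exact: linkedC.
have Q13 a b d : Q a b a d = false by exact: linked_common.
have Q14 a b d : Q a b d a = false by rewrite QC Qs.
have Qo a b c d : Q (old a) (old b) (old c) (old d) = linked G a b c d.
  exact: linked_old.
have Q1 b c d : Q new (old b) (old c) (old d) = linked G v b c d.
  exact: linked_new.
have Q3 b c d : Q (old c) (old d) new (old b) = linked G v b c d.
  by rewrite QC.
have Q4 b c d : Q (old c) (old d) (old b) new = linked G v b c d.
  by rewrite QC Qs.
have Q12 c d : Q new new (old c) (old d) = true by exact: linked_new_new.
have Q34 c d : Q (old c) (old d) new new = true by rewrite QC.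
pose T a b := (\sum_c \sum_d Q a b c d)%N.
have T_new_new : T new new = (n ^ 2)%N.
  rewrite /T sumS big1 => [|d _]; last by rewrite Q13.
  rewrite add0n (eq_bigr (fun=> n)) ?sum_nat_const ?card_ord ?mulnn // => c _.
  rewrite sumS Q14 add0n (eq_bigr (fun=> 1%N)) => [|d _]; last by rewrite Q12.
  by rewrite sum_nat_const card_ord muln1.
have T_new b : T new (old b) = (\sum_c \sum_d linked G v b c d)%N.
  rewrite /T sumS big1 => [|d _]; last by rewrite Q13.
  rewrite add0n; apply: eq_bigr => c _; rewrite sumS Q14 add0n.
  by apply: eq_bigr => d _; rewrite Q1.
have T_old a b : T (old a) (old b) =
    (1 + (\sum_x linked G v x a b + \sum_x linked G v x a b) + \sum_c \sum_d linked G a b c d)%N.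
  rewrite /T sumS sumS Q34 -!addnA; congr (_ + _)%N.
  congr (_ + _)%N; first by apply: eq_bigr => d _; rewrite Q3.
  rewrite -big_split; apply: eq_bigr => c _ /=; rewrite sumS Q4.
  by congr (_ + _)%N; apply: eq_bigr => d _; rewrite Qo.
have sumT_old a : (\sum_b T (old a) b = \sum_c \sum_d linked G v a c d +
    (n + (\sum_b \sum_x linked G v x a b + \sum_b \sum_x linked G v x a b) +
     \sum_b \sum_c \sum_d linked G a b c d))%N.
  rewrite sumS; congr (_ + _)%N.
    by rewrite -T_new; do 2![apply: eq_bigr => ? _]; rewrite Qs.
  rewrite (eq_bigr _ (fun b _ => T_old a b)) !big_split /=.
  by rewrite sum_nat_const card_ord muln1.
have -> : quartets (attach G v) = (\sum_a \sum_b T a b)%N by [].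
rewrite sumS sumS T_new_new (eq_bigr _ (fun b _ => T_new b)).
rewrite (eq_bigr _ (fun a _ => sumT_old a)) !big_split /=.
rewrite sum_nat_const card_ord.
have -> : (\sum_a \sum_b \sum_x linked G v x a b)%N = quartets_at G v.
  under eq_bigr do rewrite exchange_big.
  by rewrite exchange_big.
rewrite -/(quartets_at G v) -/(quartets G); nia.
Qed.

End Attach.

(** * A leaf of a tree *)

Lemma longest_path (T : finType) (e : rel T) (x0 : T) :
  exists x p, [/\ path e x p, uniq (x :: p) &
    forall y q, path e y q -> uniq (y :: q) -> (size q <= size p)%N].
Proof.
pose has_path k :=
  `[< exists x p, [/\ path e x p, uniq (x :: p) & size p = k] >].
have ex0 : exists k, has_path k.
  by exists 0%N; apply/asboolP; exists x0, [::].
have ub k : has_path k -> (k <= #|T|)%N.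
  move=> /asboolP[x [p [_ /= /andP[_ /card_uniqP <-] <-]]]; exact: max_card.
case: (ex_maxnP ex0 ub) => k /asboolP[x [p [pth up sp]]] kmax.
exists x, p; split=> // y q qth uq; rewrite sp; apply: kmax.
by apply/asboolP; exists y, q.
Qed.

(** An end x of a longest path p is a leaf: a neighbor outside p would extend
    it, and a neighbor on p other than the next vertex would close a cycle. *)
Lemma tree_pendant n (G : graph n) :
  is_tree G -> (1 < n)%N -> exists l p, pendant G l p.
Proof.
move=> [n_gt0 [symG irrG] conG acyclic] n_gt1.
pose x0 := Ordinal n_gt0; pose x1 := Ordinal n_gt1.
have [x [p [pth up pmax]]] := longest_path (adj G) x0.
have nbr_in z : adj G x z -> z \in p.
  move=> xz; apply: contraT => zp.
  have zx : z != x by apply: contraTneq xz => ->; rewrite irrG.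
  have := pmax z (x :: p); rewrite ltnn /= symG xz pth => /(_ isT); apply.
  by rewrite inE negb_or zx zp.
have [y xy] : exists y, adj G x y.
  pose t := if x == x0 then x1 else x0.
  have xt : x != t.
    by rewrite /t; have [->|//] := eqVneq x x0.
  case/connectP: (conG x t) => -[|y q] /=; last by case/andP=> xy; exists y.
  by move=> _ tx; rewrite tx eqxx in xt.
case: p pth up pmax nbr_in => [_ _ _ /(_ y xy)//|y' p] pth up _ nbr_in.
have xy' : adj G x y' by case/andP: pth.
exists x, y'; split=> [|z].
  by apply: contraTneq xy' => <-; rewrite irrG.
apply/idP/eqP => [xz|-> //].
apply/eqP; apply: contraT => zy'.
have zp : z \in p by have := nbr_in z xz; rewrite inE (negPf zy').
case/splitPr: zp pth up {nbr_in} => p1 p2 pth up.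
(* the part of the path from x to z, closed by the edge from z to x *)
have /acyclic : ucycle (adj G) (x :: rcons (y' :: p1) z).
  rewrite /ucycle /cycle; apply/andP; split.
    rewrite rcons_path last_rcons symG xz andbT.
    by move: pth; rewrite -cat_rcons -cat_cons cat_path => /andP[].
  move: up; rewrite -cat_rcons -!cat_cons cat_uniq => /andP[].
  by rewrite rcons_cons.
by rewrite /= size_rcons.
Qed.

(** * Expectations on finite types *)

Section Expectation.
Variable R : realType.

Definition expect (T : finType) (P : law R T) (h : T -> R) : R :=
  \sum_x P x * h x.

Lemma eq_expect (T : finType) (P : law R T) (h h' : T -> R) :
  (forall x, P x != 0 -> h x = h' x) -> expect P h = expect P h'.
Proof.
move=> hh; apply: eq_bigr => x _.
by have [->|/hh ->] := eqVneq (P x) 0; rewrite ?mul0r.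
Qed.

Lemma expect_dirac (T : finType) (a : T) h : expect (dirac_law R a) h = h a.
Proof.
rewrite /expect (bigD1 a) //= ffunE eqxx mul1r big1 ?addr0 // => x xa.
by rewrite ffunE (negPf xa) mul0r.
Qed.

Lemma expect_bind (T U : finType) (P : law R T) (K : T -> law R U) h :
  expect (bind P K) h = expect P (fun x => expect (K x) h).
Proof.
rewrite /expect; under eq_bigr do rewrite ffunE mulr_suml.
rewrite exchange_big; apply: eq_bigr => x _; rewrite mulr_sumr.
by apply: eq_bigr => y _; rewrite mulrA.
Qed.

Lemma expect_prod (T U : finType) (P : law R T) (Q : law R U) f g :
  expect (prod_law P Q) (fun z => f z.1 * g z.2) = expect P f * expect Q g.
Proof.
rewrite /expect mulr_suml.
under [RHS]eq_bigr do rewrite mulr_sumr.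
rewrite pair_big; apply: eq_bigr => -[x y] _ /=.
by rewrite ffunE /= mulrACA.
Qed.

Lemma expect_unif n h : expect (unif_law R 'I_n) h = n%:R^-1 * \sum_v h v.
Proof.
by rewrite mulr_sumr; apply: eq_bigr => v _; rewrite ffunE card_ord.
Qed.

Lemma expectD (T : finType) (P : law R T) f g :
  expect P (fun x => f x + g x) = expect P f + expect P g.
Proof. by rewrite -big_split; apply: eq_bigr => x _; rewrite mulrDr. Qed.

Lemma expectZ (T : finType) (P : law R T) c f :
  expect P (fun x => c * f x) = c * expect P f.
Proof. by rewrite mulr_sumr; apply: eq_bigr => x _; rewrite mulrCA. Qed.

Lemma expect_const (T : finType) (P : law R T) c :
  expect P (fun=> 1) = 1 -> expect P (fun=> c) = c.
Proof.
move=> P1; rewrite -[RHS]mulr1 -P1 -expectZ.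
by apply: eq_expect => x _; rewrite mulr1.
Qed.

Lemma prob_expect (T : finType) (P : law R T) (A : {set T}) :
  prob P A = expect P (fun x => (x \in A)%:R).
Proof.
rewrite /prob /expect big_mkcond; apply: eq_bigr => x _ /=.
by case: ifP => _; rewrite ?mulr1 ?mulr0.
Qed.

Definition is_law (T : finType) (P : law R T) : Prop :=
  (forall x, 0 <= P x) /\ expect P (fun=> 1) = 1.

Lemma is_law_dirac (T : finType) (a : T) : is_law (dirac_law R a).
Proof. by split=> [x|]; rewrite ?expect_dirac // ffunE ler0n. Qed.

Lemma is_law_bind (T U : finType) (P : law R T) (K : T -> law R U) :
  is_law P -> (forall x, is_law (K x)) -> is_law (bind P K).
Proof.
move=> [P0 P1] KL; split=> [y|].
  by rewrite ffunE sumr_ge0 // => x _; rewrite mulr_ge0 //; case: (KL x).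
rewrite expect_bind -[RHS]P1; apply: eq_expect => x _.
by case: (KL x).
Qed.

Lemma is_law_prod (T U : finType) (P : law R T) (Q : law R U) :
  is_law P -> is_law Q -> is_law (prod_law P Q).
Proof.
move=> [P0 P1] [Q0 Q1]; split=> [z|]; first by rewrite ffunE mulr_ge0.
have := expect_prod P Q (fun=> 1) (fun=> 1).
by rewrite P1 Q1 mulr1.
Qed.

Lemma is_law_unif n : (0 < n)%N -> is_law (unif_law R 'I_n).
Proof.
move=> n0; split=> [v|]; first by rewrite ffunE invr_ge0 ler0n.
by rewrite expect_unif sumr_const card_ord mulVf // pnatr_eq0 -lt0n.
Qed.

Lemma expect_ge0 (T : finType) (P : law R T) h : is_law P ->
  (forall x, 0 <= h x) -> 0 <= expect P h.
Proof. by move=> [P0 _] h0; rewrite sumr_ge0 // => x _; rewrite mulr_ge0. Qed.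

Lemma expect_le1 (T : finType) (P : law R T) h : is_law P ->
  (forall x, h x <= 1) -> expect P h <= 1.
Proof.
move=> [P0 P1] h1; rewrite -[leRHS]P1 /expect.
by apply: ler_sum => x _; rewrite ler_wpM2l.
Qed.

(** For any centre c: two distinct values of h cannot both equal c. *)
Lemma variance_gt0 (T : finType) (P : law R T) h c x y : is_law P ->
  0 < P x -> 0 < P y -> h x != h y -> 0 < expect P (fun z => (h z - c) ^+ 2).
Proof.
move=> [P0 _] Px Py hxy.
wlog hxc : x y Px Py hxy / h x != c.
  move=> IH; have [hxc|hxc] := eqVneq (h x) c; last exact: (IH x y).
  by apply: (IH y x); rewrite // 1?eq_sym -?hxc // eq_sym.
rewrite /expect (bigD1 x) //= ltr_pwDl //.
  by rewrite mulr_gt0 // exprn_even_gt0 // subr_eq0.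
by rewrite sumr_ge0 // => z _; rewrite mulr_ge0 // sqr_ge0.
Qed.

(** * Total variation *)

Lemma TV_ubound (T : finType) (P Q : law R T) A :
  `|prob P A - prob Q A| <= TV P Q.
Proof.
apply: ub_le_sup; last by exists A.
exists (\sum_x `|P x - Q x|) => _ [B _ <-].
rewrite /prob -sumrB (le_trans (ler_norm_sum _ _ _)) // big_mkcond /=.
by apply: ler_sum => x _; case: ifP.
Qed.

Lemma TV_ge0 (T : finType) (P Q : law R T) : 0 <= TV P Q.
Proof. exact: le_trans (TV_ubound P Q finset.set0). Qed.

Lemma TV_le (T : finType) (P Q : law R T) c :
  (forall A, `|prob P A - prob Q A| <= c) -> TV P Q <= c.
Proof.
move=> le_c; apply: ge_sup; last by move=> _ [A _ <-].
by exists `|prob P finset.set0 - prob Q finset.set0|, finset.set0.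
Qed.

Lemma TVC (T : finType) (P Q : law R T) : TV P Q = TV Q P.
Proof.
by apply: le_anti; rewrite !TV_le // => A; rewrite distrC TV_ubound.
Qed.

(** A function with values in [0, 1] does no better than the indicator of the
    set where one mass function exceeds the other. *)
Lemma TV_test (T : finType) (P Q : law R T) (h : T -> R) :
  (forall x, 0 <= h x <= 1) -> `|expect P h - expect Q h| <= TV P Q.
Proof.
suff one (P' Q' : law R T) : (forall x, 0 <= h x <= 1) ->
    expect P' h - expect Q' h <= TV P' Q'.
  move=> h01; rewrite ler_norml one // andbT lerNl opprB TVC.
  exact: one.
move=> h01.
pose A := [set x | Q' x < P' x]%SET.
apply: le_trans (TV_ubound P' Q' A); apply: le_trans (ler_norm _).
rewrite /prob -!sumrB big_mkcond [leRHS]big_mkcond /=.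
apply: ler_sum => x _; rewrite inE -mulrBl.
have /andP[h0 h1] := h01 x.
case: ltP => PQ; first by rewrite ler_piMr // subr_ge0 ltW.
by rewrite mulr_le0_ge0 // subr_le0.
Qed.

(** Data processing: the probability of an event after the kernel is the
    mean of a [0, 1]-valued function before it. *)
Lemma TV_bind (T U : finType) (P Q : law R T) (K : T -> law R U) :
  (forall x, is_law (K x)) -> TV (bind P K) (bind Q K) <= TV P Q.
Proof.
move=> KL; apply: TV_le => A; rewrite !prob_expect !expect_bind.
apply: TV_test => x; rewrite expect_ge0 ?expect_le1 //= => y.
by rewrite lern1 leq_b1.
Qed.

Lemma bindA (T U V : finType) (P : law R T) (K : T -> law R U)
    (L : U -> law R V) :
  bind (bind P K) L = bind P (fun x => bind (K x) L).
Proof.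
apply/ffunP => z; rewrite !ffunE -[LHS]/(expect _ (fun y => L y z)) expect_bind.
by apply: eq_bigr => x _; rewrite [X in _ = _ * X]ffunE.
Qed.

Lemma bind_dirac (T U : finType) (a : T) (K : T -> law R U) :
  bind (dirac_law R a) K = K a.
Proof. by apply/ffunP => y; rewrite ffunE -/(expect _ _) expect_dirac. Qed.

Lemma eq_bind (T U : finType) (P : law R T) (K L : T -> law R U) :
  (forall x, K x = L x) -> bind P K = bind P L.
Proof.
by move=> KL; apply/ffunP => y; rewrite !ffunE; apply: eq_bigr => x _; rewrite KL.
Qed.

Lemma prod_bind (T U T' U' : finType) (P : law R T) (K : T -> law R U)
    (P' : law R T') (K' : T' -> law R U') :
  prod_law (bind P K) (bind P' K') =
  bind (prod_law P P') (fun z => prod_law (K z.1) (K' z.2)).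
Proof.
apply/ffunP => -[y y']; rewrite !ffunE /=.
rewrite -/(expect P (fun x => K x y)) -/(expect P' (fun x => K' x y')).
rewrite -expect_prod; apply: eq_bigr => -[x x'] _.
by rewrite [X in _ = _ * X]ffunE.
Qed.

End Expectation.

(** * Isomorphism classes *)

Lemma isomorphic_refl n (G : graph n) : isomorphic G G.
Proof. by exists id; split=> //; exists id. Qed.

Lemma isomorphic_sym m n (G : graph m) (H : graph n) :
  isomorphic G H -> isomorphic H G.
Proof.
move=> [f [[g fK gK] fG]]; exists g; split; first by exists f.
by move=> x y; rewrite -fG !gK.
Qed.

Lemma isomorphic_trans m n p (G : graph m) (H : graph n) (K : graph p) :
  isomorphic G H -> isomorphic H K -> isomorphic G K.
Proof.
move=> [f [bf fG]] [g [bg gH]]; exists (g \o f); split.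
  exact: bij_comp.
by move=> x y; rewrite /= gH fG.
Qed.

Lemma unlabel_iso n p q (G : graph p) (H : graph q) :
  isomorphic G H -> unlabel n G = unlabel n H.
Proof.
move=> GH; apply/finset.setP => K; rewrite !inE; apply/asboolP/asboolP.
- exact/isomorphic_trans/isomorphic_sym.
- exact: isomorphic_trans.
Qed.

(** The isomorphism of the old graphs is extended by sending the new vertex to
    the new vertex. *)
Lemma isomorphic_attach m n (G : graph m) (H : graph n) (f : 'I_m -> 'I_n) v :
  bijective f -> (forall x y, adj H (f x) (f y) = adj G x y) ->
  isomorphic (attach G v) (attach H (f v)).
Proof.
pose ext p q (h : 'I_p -> 'I_q) (x : 'I_p.+1) : 'I_q.+1 :=
  oapp (fun y => lift ord_max (h y)) ord_max (unlift ord_max x).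
have ext_old p q (h : 'I_p -> 'I_q) x :
    ext p q h (lift ord_max x) = lift ord_max (h x) by rewrite /ext liftK.
have ext_new p q (h : 'I_p -> 'I_q) : ext p q h ord_max = ord_max.
  by rewrite /ext unlift_none.
have extK p q (h : 'I_p -> 'I_q) g : cancel h g -> cancel (ext p q h) (ext q p g).
  move=> hK x; case: (vertexP x) => [y|]; last by rewrite !ext_new.
  by rewrite !ext_old hK.
move=> [g fK gK] fG; exists (ext m n f); split.
  by exists (ext n m g); apply: extK.
have f_eq x : (f x == f v) = (x == v) by rewrite (can_eq fK).
move=> x y; case: (vertexP x) => [a|]; case: (vertexP y) => [b|].
- by rewrite !ext_old !adj_old fG.
- by rewrite ext_old ext_new !adj_old_new f_eq.
- by rewrite ext_old ext_new !adj_new_old f_eq.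
- by rewrite !ext_new !adj_new.
Qed.

Section Growth.
Variable R : realType.

(** * Monotonicity of the total variation distance *)

Lemma is_law_step n (G : graph n) : (0 < n)%N -> is_law (ua_step R G).
Proof.
move=> n0; apply: is_law_bind; first exact: is_law_unif.
by move=> v; apply: is_law_dirac.
Qed.

Lemma is_law_grow k m (S : graph m) : (0 < m)%N -> is_law (ua_grow R k S).
Proof.
move=> m0; elim: k => [|k IH]; first exact: is_law_dirac.
by apply: is_law_bind => // G; apply: is_law_step; rewrite addn_gt0 m0 orbT.
Qed.

Definition step_class N m (G : graph m) : law R (ugraph N) :=
  bind (ua_step R G) (fun H => dirac_law R (unlabel N H)).

(** Reindexing the uniform attachment vertex by the isomorphism. *)
Lemma step_class_iso N n (G H : graph n) :
  isomorphic G H -> step_class N G = step_class N H.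
Proof.
move=> [f [bf fG]].
have step (K : graph n) U : step_class N K U =
    n%:R^-1 * \sum_v dirac_law R (unlabel N (attach K v)) U.
  rewrite /step_class /ua_step bindA ffunE.
  rewrite -[LHS]/(expect _ (fun v => bind (dirac_law R (attach K v)) _ U)).
  by rewrite expect_unif; under eq_bigr do rewrite bind_dirac.
apply/ffunP => U; rewrite !step [in RHS](reindex f) /=; last exact: onW_bij.
congr (_ * _); apply: eq_bigr => v _.
by rewrite (unlabel_iso N (isomorphic_attach v bf fG)).
Qed.

(** One step of growth seen on unlabeled graphs: the choice of representative
    is harmless by [step_class_iso]; the empty set, which is the class of no
    graph, is given an arbitrary law. *)
Definition class_step n (U : ugraph n) : law R (ugraph n.+1) :=
  if [pick H in U] is Some H then step_class n.+1 H
  else dirac_law R finset.set0.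

Lemma class_step_unlabel n m (G : graph m) : m = n ->
  class_step (unlabel n G) = step_class n.+1 G.
Proof.
move=> mn; subst m; rewrite /class_step; case: pickP => [H|].
  by rewrite inE => /asboolP GH; rewrite -(step_class_iso _ GH).
by move=> /(_ G); rewrite inE => /asboolPn[]; apply: isomorphic_refl.
Qed.

Lemma is_law_class_step n (U : ugraph n) : (0 < n)%N -> is_law (class_step U).
Proof.
move=> n0; rewrite /class_step; case: pickP => [H _|_]; last exact: is_law_dirac.
apply: is_law_bind; first exact: is_law_step.
by move=> K; apply: is_law_dirac.
Qed.

(** Uniform attachment remains a Markov chain after forgetting the labels. *)
Lemma UA_succ n m (G : graph m) : (m <= n)%N ->
  UA R n.+1 G = bind (UA R n G) (@class_step n).
Proof.
move=> mn; rewrite /UA subSn //= !bindA; apply: eq_bind => H.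
by rewrite bind_dirac class_step_unlabel ?subnK.
Qed.

Lemma TV_CUA_nonincreasing n t m (S : graph m) :
  (0 < m)%N -> (m <= t)%N -> (t <= n)%N ->
  TV (CUA R n.+1 t S) (UA2 R n.+1 S) <= TV (CUA R n t S) (UA2 R n S).
Proof.
move=> m0 mt tn.
pose K (z : ugraph n * ugraph n) := prod_law (class_step z.1) (class_step z.2).
have -> : CUA R n.+1 t S = bind (CUA R n t S) K.
  rewrite /CUA bindA; apply: eq_bind => G.
  by rewrite UA_succ ?subnK // prod_bind.
have -> : UA2 R n.+1 S = bind (UA2 R n S) K.
  by rewrite /UA2 UA_succ ?prod_bind // (leq_trans mt).
have n0 : (0 < n)%N by rewrite (leq_trans m0) // (leq_trans mt).
by apply: TV_bind => z; apply: is_law_prod; apply: is_law_class_step.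
Qed.

(** * The mean number of linked quadruples *)

(** The conditional mean of the statistic after a step from size n. *)
Definition drift (n : nat) (x : R) : R :=
  x * (1 + 4 / n%:R) + 2 * n%:R ^+ 2.

Fixpoint grow_mean (m k : nat) (x : R) : R :=
  if k is k'.+1 then drift (k' + m) (grow_mean m k' x) else x.

Lemma grow_mean_add m j k x :
  grow_mean m (k + j) x = grow_mean (j + m) k (grow_mean m j x).
Proof. by elim: k => //= k ->; rewrite addnA. Qed.

(** Affine maps commute with expectations. *)
Lemma expect_grow_mean (T : finType) (P : law R T) h m k : is_law P ->
  expect P (fun x => grow_mean m k (h x)) = grow_mean m k (expect P h).
Proof.
move=> [_ P1]; elim: k => //= k <-; rewrite /drift expectD.
rewrite (expect_const _ P1); congr (_ + _).
rewrite [RHS]mulrC -expectZ; apply: eq_expect => x _.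
by rewrite mulrC.
Qed.

(** The rising factorial n(n+1)(n+2)(n+3): it satisfies
    rising4 (n+1) = (1 + 4/n) rising4 n, so it integrates the linear part of
    the recursion. *)
Definition rising4 (n : nat) : R :=
  n%:R * (n%:R + 1) * (n%:R + 2) * (n%:R + 3).

Lemma grow_mean_sub m k x y : (0 < m)%N ->
  (grow_mean m k x - grow_mean m k y) * rising4 m = (x - y) * rising4 (k + m).
Proof.
move=> m0; elim: k => [//|k IH] /=.
have j0 : ((k + m)%:R : R) != 0 by rewrite pnatr_eq0 -lt0n addn_gt0 m0 orbT.
have -> : rising4 (k.+1 + m) = rising4 (k + m) * (1 + 4 / (k + m)%:R).
  rewrite /rising4 addSn -[(k + m).+1%:R]natr1.
  by move: (k + m)%:R j0 => j j0; field.
by rewrite mulrA -IH /drift; ring.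
Qed.

(** In [quartets_attach], the average of [quartets_at G v] over v is
    [quartets G / n]. *)
Lemma expect_step n (G : graph n) : (0 < n)%N -> graph_connected G ->
  expect (ua_step R G) (fun H => (quartets H)%:R) = drift n (quartets G)%:R.
Proof.
move=> n0 conG; rewrite expect_bind.
rewrite (eq_expect (h' := fun v => (quartets (attach G v))%:R)); last first.
  by move=> v _; rewrite expect_dirac.
rewrite expect_unif.
under eq_bigr do rewrite quartets_attach // natrD natrD.
have sum_const (x : R) : \sum_(v < n) x = n%:R * x.
  by rewrite sumr_const card_ord mulr_natl.
rewrite !big_split /= !sum_const.
under [X in _ + X + _]eq_bigr do rewrite natrM.
rewrite -mulr_sumr -natr_sum -sum_quartets_at /drift natrM natrX.
have : (n%:R : R) != 0 by rewrite pnatr_eq0 -lt0n.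
by move=> ?; field.
Qed.

Lemma connected_grow k m (S : graph m) G :
  graph_connected S -> ua_grow R k S G != 0 -> graph_connected G.
Proof.
move=> conS; elim: k G => [|k IH] G /=.
  by rewrite ffunE pnatr_eq0 eqb0 negbK => /eqP ->.
have ex (T : finType) (F : T -> R) : \sum_x F x != 0 -> exists x, F x != 0.
  move=> F0; apply/existsP; apply: contraNT F0.
  move=> /existsPn F0; rewrite big1 // => x _; apply/eqP.
  by have := F0 x; rewrite negbK.
rewrite ffunE => /ex[H]; rewrite mulf_eq0 negb_or => /andP[/IH conH].
rewrite ffunE => /ex[v]; rewrite mulf_eq0 negb_or => /andP[_].
rewrite ffunE pnatr_eq0 eqb0 negbK => /eqP ->.
exact: attach_connected.
Qed.

Lemma expect_grow k m (S : graph m) : (0 < m)%N -> graph_connected S ->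
  expect (ua_grow R k S) (fun G => (quartets G)%:R) =
  grow_mean m k (quartets S)%:R.
Proof.
move=> m0 conS; elim: k => [|k IH] /=; first by rewrite expect_dirac.
rewrite expect_bind.
rewrite (eq_expect (h' := fun G => grow_mean (k + m) 1 (quartets G)%:R)).
  by rewrite (expect_grow_mean _ _ _ (is_law_grow _ _ m0)) IH.
move=> G /(connected_grow conS) conG.
by rewrite expect_step // addn_gt0 m0 orbT.
Qed.

(** * The density of linked quadruples in an unlabeled graph *)

(** The statistic is constant on a class, so the maximum only reads off its
    common value without choosing a representative. *)
Definition density n (U : ugraph n) : R :=
  (\max_(H in U) quartets H)%N%:R / n%:R ^+ 4.

Lemma density_unlabel n m (G : graph m) : m = n ->
  density (unlabel n G) = (quartets G)%:R / n%:R ^+ 4.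
Proof.
move=> mn; subst m; congr (_%:R / _); apply/eqP; rewrite eqn_leq.
apply/andP; split.
  apply/bigmax_leqP => H; rewrite inE => /asboolP GH.
  by rewrite (quartets_iso GH).
apply: (@leq_bigmax_cond _ _ (fun H => quartets H)).
by rewrite inE; apply/asboolP/isomorphic_refl.
Qed.

Lemma density_itv n (U : ugraph n) : 0 <= density U <= 1.
Proof.
rewrite /density divr_ge0 ?ler0n ?exprn_ge0 //=.
have [n0|n0] := posnP n; first by rewrite (_ : n%:R ^+ 4 = 0) ?invr0 ?mulr0 // n0 expr0n.
rewrite ler_pdivrMr ?exprn_gt0 ?ltr0n // mul1r -natrX ler_nat.
by apply/bigmax_leqP => H _; apply: quartets_le.
Qed.

Lemma expect_UA_density n m (G : graph m) :
  (0 < m)%N -> (m <= n)%N -> graph_connected G ->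
  expect (UA R n G) (@density n) =
  grow_mean m (n - m) (quartets G)%:R / n%:R ^+ 4.
Proof.
move=> m0 mn conG; rewrite expect_bind -expect_grow // mulrC -expectZ.
apply: eq_expect => H _; rewrite expect_dirac density_unlabel ?subnK //.
by rewrite mulrC.
Qed.

(** * A uniform lower bound *)

(** Test function: the product of the two densities.  With u the conditional
    mean of the density given the common tree and c the mean of u, the two
    expectations differ by the variance of u, and u - c is the deviation of
    the number of linked quadruples at time t times
    rising4 n / (n^4 rising4 t), at least 1 / rising4 t. *)
Lemma TV_CUA_ge n t m (S : graph m) (P := ua_grow R (t - m) S)
    (mu := expect P (fun G => (quartets G)%:R)) :
  (0 < m)%N -> (m <= t)%N -> (t <= n)%N -> graph_connected S ->
  expect P (fun G => ((quartets G)%:R - mu) ^+ 2) / rising4 t ^+ 2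
  <= TV (CUA R n t S) (UA2 R n S).
Proof.
move=> m0 mt tn conS.
have t0 : (0 < t)%N by rewrite (leq_trans m0).
have n0 : (0 < n)%N by rewrite (leq_trans t0).
have lawP : is_law P by exact: is_law_grow.
pose u (G : graph (t - m + m)) : R :=
  grow_mean t (n - t) (quartets G)%:R / n%:R ^+ 4.
pose c : R := grow_mean t (n - t) mu / n%:R ^+ 4.
pose h (z : ugraph n * ugraph n) : R := density z.1 * density z.2.
have uE G : P G != 0 -> expect (UA R n G) (@density n) = u G.
  move=> /(connected_grow conS) conG.
  rewrite expect_UA_density ?subnK // /u.
  by congr (grow_mean _ (n - _) _ / _); rewrite subnK.
have cE : expect (UA R n S) (@density n) = c.
  rewrite expect_UA_density ?(leq_trans mt) // /c /mu expect_grow //.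
  have -> : (n - m = (n - t) + (t - m))%N by lia.
  by rewrite grow_mean_add subnK.
have uc : expect P u = c.
  rewrite /c -expect_grow_mean // mulrC -expectZ; apply: eq_expect => G _.
  by rewrite /u mulrC.
have CE : expect (CUA R n t S) h = expect P (fun G => u G ^+ 2).
  rewrite expect_bind; apply: eq_expect => G PG.
  by rewrite expect_prod uE // expr2.
have UE : expect (UA2 R n S) h = c ^+ 2 by rewrite expect_prod cE expr2.
have h01 z : 0 <= h z <= 1.
  have /andP[a0 a1] := density_itv z.1; have /andP[b0 b1] := density_itv z.2.
  by apply/andP; split; [apply: mulr_ge0|apply: mulr_ile1].
apply: le_trans (TV_test _ _ h01); apply: le_trans (ler_norm _).
have -> : expect (CUA R n t S) h - expect (UA2 R n S) h =
    expect P (fun G => (u G - c) ^+ 2).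
  rewrite CE UE.
  rewrite (eq_expect (h := fun G => (u G - c) ^+ 2)
     (h' := fun G => u G ^+ 2 + (- (2 * c) * u G + c ^+ 2))); last first.
    by move=> G _; ring.
  rewrite !expectD expectZ uc (expect_const _ lawP.2).
  by ring.
rewrite mulrC -expectZ; apply: ler_sum => G _; rewrite ler_wpM2l //.
  by case: lawP.
have r0 : 0 < rising4 t by rewrite /rising4 !mulr_gt0 ?ltr_wpDl ?ltr0n.
have n40 : 0 < n%:R ^+ 4 :> R by rewrite exprn_gt0 ?ltr0n.
have -> : u G - c = ((quartets G)%:R - mu) / rising4 t *
    (rising4 n / n%:R ^+ 4).
  have := grow_mean_sub (n - t) (quartets G)%:R mu t0.
  rewrite (subnK tn) => E.
  rewrite mulrA [X in X / _]mulrAC -E /u /c -mulrBl mulfK // gt_eqF //.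
rewrite [leLHS]mulrC -[(rising4 t ^+ 2)^-1]exprVn -exprMn [leRHS]exprMn.
rewrite ler_peMr ?sqr_ge0 // exprn_ege1 // ler_pdivlMr // mul1r.
rewrite /rising4 !exprSr expr0 mul1r.
by rewrite !ler_pM ?mulr_ge0 ?ler_wpDr.
Qed.

(** * Two different continuations of the seed *)

Lemma attach_pos k m (S : graph m) (G : graph (k + m)) v : (0 < m)%N ->
  0 < ua_grow R k S G -> 0 < ua_grow R k.+1 S (attach G v).
Proof.
move=> m0 PG; have [P0 _] := is_law_grow k S m0.
have km0 : (0 < k + m)%N by rewrite addn_gt0 m0 orbT.
have step0 : 0 < ua_step R G (attach G v).
  rewrite ffunE (bigD1 v) //= !ffunE eqxx mulr1 card_ord.
  rewrite ltr_pwDl ?invr_gt0 ?ltr0n // sumr_ge0 // => w _.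
  by rewrite !ffunE mulr_ge0 ?invr_ge0 ?ler0n.
rewrite /= ffunE (bigD1 G) //= ltr_pwDl ?mulr_gt0 // sumr_ge0 // => H _.
by rewrite mulr_ge0 //; case: (is_law_step H km0).
Qed.

(** The leaf is the vertex attached last; if there was no growth yet, it is
    a leaf of the seed. *)
Lemma grow_pos_pendant k m (S : graph m) : is_tree S -> (1 < k + m)%N ->
  exists G, [/\ 0 < ua_grow R k S G, graph_connected G &
                exists l p, pendant G l p].
Proof.
move=> treeS; have [m0 [symS _] conS _] := treeS.
have Spos : 0 < ua_grow R 0 S S by rewrite ffunE eqxx.
case: k => [m1|k _].
  by exists S; split=> //; apply: tree_pendant.
have [G [PG conG]] : exists G, 0 < ua_grow R k S G /\ graph_connected G.
  elim: k => [|k [G [PG conG]]]; first by exists S.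
  have v : 'I_(k + m) by apply: (@Ordinal _ 0); rewrite addn_gt0 m0 orbT.
  by exists (attach G v); split; [apply: attach_pos|apply: attach_connected].
have v : 'I_(k + m) by apply: (@Ordinal _ 0); rewrite addn_gt0 m0 orbT.
exists (attach G v); split; [exact: attach_pos|exact: attach_connected|].
by exists ord_max, (lift ord_max v); apply: pendant_attach.
Qed.

(** The trees are grown up to size t - 1; there, the last vertex is attached
    either to a leaf or to its neighbor. *)
Lemma quartets_variance_gt0 m t (S : graph m) c :
  is_tree S -> (m < t)%N -> (3 < t)%N ->
  0 < expect (ua_grow R (t - m) S) (fun G => ((quartets G)%:R - c) ^+ 2).
Proof.
move=> treeS mt t3; have [m0 _ _ _] := treeS.
have -> : (t - m)%N = (t - m).-1.+1 by rewrite prednK // subn_gt0.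
set k := (t - m).-1; have km : (2 < k + m)%N by rewrite /k; lia.
have [G [PG conG [l [p pend]]]] := grow_pos_pendant treeS (ltnW km).
apply: (@variance_gt0 _ _ _ _ _ (attach G l) (attach G p)).
- exact: (is_law_grow k.+1 S m0).
- exact: attach_pos.
- exact: attach_pos.
rewrite eqr_nat !quartets_attach // gtn_eqF // ltn_add2r ltn_add2l ltn_pmul2l //.
by apply: quartets_at_neighbor_lt pend km; case: conG.
Qed.

End Growth.

Theorem corollary1p5 (R : realType) (s : nat) (S : graph s) (tstar : nat)
    (treeS : is_tree S) (lt_s_tstar : (s < tstar)%N) (lt_3_tstar : (3 < tstar)%N) :
  let tv := fun n : nat => TV (CUA R n tstar S) (UA2 R n S) in
  cvgn tv /\ 0 < limn tv.
Proof.
move=> tv; have [s0 [symS _] conS _] := treeS.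
have cv : cvgn tv.
  (* the distance is monotone from tstar on only, hence the shift *)
  apply/cvg_ex; pose u n := tv (n + tstar)%N.
  have /cvg_ex[l ul] : cvgn u.
    apply: nonincreasing_is_cvgn.
      apply/nonincreasing_seqP => n.
      by apply: TV_CUA_nonincreasing; rewrite ?leq_addl // ltnW.
    by exists 0 => _ [n _ <-]; apply: TV_ge0.
  by exists l; rewrite -(cvg_shiftn tstar).
split=> //; pose P := ua_grow R (tstar - s) S.
pose c := expect P (fun G => (quartets G)%:R).
pose V := expect P (fun G => ((quartets G)%:R - c) ^+ 2).
apply: (@lt_le_trans _ _ (V / rising4 R tstar ^+ 2)).
  rewrite divr_gt0 ?quartets_variance_gt0 // exprn_gt0 // /rising4.
  by rewrite !mulr_gt0 ?ltr_wpDl ?ltr0n // (leq_trans _ lt_s_tstar).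
apply: limr_ge => //; exists tstar => // n /= tn.
by apply: TV_CUA_ge; rewrite // ltnW.
Qed.
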